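(* Let $n\ge1$, let $\Omega:\mathbb{R}^n\setminus\{0\}\to\mathbb{R}$ be odd, homogeneous of degree zero, with restriction to $S^{n-1}$ Lipschitz, with $\int_{S^{n-1}}\Omega=0$, and such that the set $\{\Omega=0\}$ has measure zero. Let $$Tf(x)=\mathrm{p.v.}\int_{\mathbb{R}^n}\frac{\Omega(x-y)}{|x-y|^n}f(y)\,dy .$$ (In particular, $T$ may be any one of the Riesz transforms $R_jf(x)=\mathrm{p.v.}\int_{\mathbb{R}^n}\frac{x_j-y_j}{|x-y|^{n+1}}f(y)\,dy$, $1\le j\le n$.) Let $b$ be a real-valued locally integrable function on $\mathbb{R}^n$, and suppose there exists a constant $B$ such that $$|\{x\in\mathbb{R}^n:\ |[b,T]f(x)|>t\}|\le\int_{\mathbb{R}^n}\frac{B|f(x)|}{t}\left(1+\log^+\left(\frac{B|f(x)|}{t}\right)\right)dx$$ for all $t>0$ and all bounded measurable functions $f$ on $\mathbb{R}^n$ with compact support. Then $b\in\mathrm{BMO}(\mathbb{R}^n)$.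
   Context: $|\cdot|$ of a set is Lebesgue measure and $\log^+t=\max(\log t,0)$, with the integrand on the right-hand side equal to $0$ where $f=0$. The commutator is $[b,T]f=T(bf)-bT(f)$, with principal values understood as limits as $\varepsilon\to0$ of integrals over $|x-y|>\varepsilon$. It is defined a.e. for bounded compactly supported $f$. $\mathrm{BMO}(\mathbb{R}^n)$ is the set of $b\in L^1_{\mathrm{loc}}(\mathbb{R}^n)$ with $\sup_Q\frac1{|Q|}\int_Q|b(x)-b_Q|\,dx<\infty$, the supremum being over cubes $Q$ with edges parallel to the axes, with $b_Q=\frac1{|Q|}\int_Qb$. *)

(* Defs.v *)
From HB Require Import structures.
From mathcomp Require Import all_boot all_order all_algebra.
From mathcomp Require Import all_classical all_reals all_analysis.

Set Implicit Arguments.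
Unset Strict Implicit.
Unset Printing Implicit Defensive.
Import Order.TTheory GRing.Theory Num.Theory.
Import numFieldNormedType.Exports.
Local Open Scope classical_set_scope.
Local Open Scope ring_scope.

(* Throughout, the dimension is n.+1 and the space is
   'rV[R]_n.+1. The library norm `|x| on row vectors is the sup norm, hence the
   separate Euclidean norm below; the library topology is the usual one. *)

Section lebesgue_measure_rV.
Context (R : realType) (n : nat).
Local Notation V := 'rV[R]_n.+1.
Implicit Types (A B : set V) (I : V * V).

Definition box I : set V :=
  [set x | forall i, I.1 ord0 i <= x ord0 i < I.2 ord0 i].

Definition box_vol I : R := \prod_i Num.max (I.2 ord0 i - I.1 ord0 i) 0.

Local Open Scope ereal_scope.

Definition box_cover A : set ((V * V)^nat) :=
  [set I | A `<=` \bigcup_k box (I k)].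

Definition lebesgue_outer A : \bar R :=
  ereal_inf [set \sum_(k <oo) (box_vol (I k))%:E | I in box_cover A].

Lemma box_vol_ge0 I : 0 <= (box_vol I)%:E.
Proof. by rewrite lee_fin prodr_ge0// => i _; rewrite le_max lexx orbT. Qed.

Lemma lebesgue_outer_ge0 A : 0 <= lebesgue_outer A.
Proof.
apply: le_ereal_inf_tmp => _ [I _ <-].
by apply: nneseries_ge0 => k _ _; exact: box_vol_ge0.
Qed.

Lemma lebesgue_outer0 : lebesgue_outer set0 = 0.
Proof.
apply/eqP; rewrite eq_le lebesgue_outer_ge0 andbT.
apply: ereal_inf_lbound; exists (fun=> (0, 0)%R) => //=.
rewrite eseries0// => k _ _.
by rewrite /box_vol big_ord_recl /= subrr maxxx mul0r.
Qed.

Lemma le_lebesgue_outer :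
  {homo lebesgue_outer : A B / A `<=` B >-> A <= B}.
Proof.
move=> A B AB; apply/ereal_inf_le_tmp => _ [I BI <-].
by exists I => //; exact: subset_trans AB BI.
Qed.

Lemma lebesgue_outer_sigma_subadditive : sigma_subadditive lebesgue_outer.
Proof.
move=> A; have [[i ioo]|] := pselect (exists i, lebesgue_outer (A i) = +oo).
  rewrite (eseries_pinfty _ _ ioo) ?leey// => k _.
  by rewrite -ltNye (lt_le_trans _ (lebesgue_outer_ge0 _)).
rewrite -forallNE => Aoo.
suff add2e (e : {posnum R}) : lebesgue_outer (\bigcup_k A k) <=
    \sum_(i <oo) lebesgue_outer (A i) + e%:num%:E.
  by apply/lee_addgt0Pr => _/posnumP[].
rewrite (le_trans _ (epsilon_trick _ _ _))//; last first.
  by move=> k; exact: lebesgue_outer_ge0.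
pose P k (I : (V * V)^nat) := box_cover (A k) I /\
  \sum_(j <oo) (box_vol (I j))%:E <=
  lebesgue_outer (A k) + (e%:num / (2 ^ k.+1)%:R)%:E.
have [G PG] : {G : ((V * V)^nat)^nat & forall k, P k (G k)}.
  apply: (@choice _ _ P) => k; rewrite /P.
  have fA : lebesgue_outer (A k) \is a fin_num.
    by rewrite ge0_fin_numE ?lebesgue_outer_ge0// ltey; exact/eqP/Aoo.
  have ek : (0 < e%:num / (2 ^ k.+1)%:R)%R by [].
  have [_ [I AI <-] Ie] := lb_ereal_inf_adherent ek fA.
  by exists I; split => //; exact/ltW.
pose v (p : nat * nat) := (box_vol (G p.1 p.2))%:E.
have v_ge0 p : 0 <= v p by exact: box_vol_ge0.
apply: (@le_trans _ _ (\esum_(p in setT) v p)).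
  apply: ereal_inf_lbound => /=.
  have /card_esym/ppcard_eqP[f] := card_nat2.
  exists (fun k => G (f k).1 (f k).2).
    move=> x [i _ /((PG i).1)[j _ xij]]; exists (f^-1%FUN (i, j)) => //=.
    by rewrite invK ?inE.
  rewrite -(esum_pred_image v _ xpredT) ?[fun=> _]set_true//; first by rewrite image_eq.
rewrite (_ : esum _ _ = \sum_(i <oo) \sum_(j <oo) v (i, j)); last first.
  pose J : nat -> set (nat * nat) := fun i => [set (i, j) | j in setT].
  rewrite (_ : setT = \bigcup_k J k); last first.
    by rewrite predeqE => -[a b]; split => // _; exists a => //; exists b.
  rewrite esum_bigcupT //=; last first.
    apply/trivIsetP => i j _ _ ij.
    rewrite predeqE => -[k m] /=; split => //= -[] [_] _ [<-{k} _].
    by move=> [m' _] [] /esym/eqP; rewrite (negbTE ij).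
  rewrite -(image_id [set: nat]) -fun_true esum_pred_image//; last first.
    by move=> k _; exact: esum_ge0.
  apply: eq_eseriesr => /= j _.
  rewrite -(esum_pred_image v (pair j) predT)//=; last first.
    by move=> ? ? _ _; exact: (@can_inj _ _ _ snd).
  by congr esum; rewrite predeqE => -[a b]; split; move=> [i _ <-]; exists i.
apply: lee_nneseries => [i *|i *]; first by apply: nneseries_ge0 => *.

exact: (PG i).2.
Qed.

HB.instance Definition _ := isOuterMeasure.Build R V lebesgue_outer
  lebesgue_outer0 lebesgue_outer_ge0 le_lebesgue_outer
  lebesgue_outer_sigma_subadditive.

Definition lebesgue_outer_measure : {outer_measure set V -> \bar R} :=
  lebesgue_outer.

(* R^(n.+1) with the Lebesgue (not merely Borel) measurable sets, i.e. the
   Caratheodory sets of the outer measure; it is convertible to 'rV[R]_n.+1. *)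
Definition lebesgue_rV : measurableType _ :=
  caratheodory_type lebesgue_outer_measure.

Definition leb : {measure set lebesgue_rV -> \bar R} :=
  (lebesgue_outer_measure : set (caratheodory_type lebesgue_outer_measure) -> _).

End lebesgue_measure_rV.
Arguments leb {R n}.
Arguments lebesgue_rV : clear implicits.

Section commutators.
Context (R : realType) (n : nat).
Local Notation V := 'rV[R]_n.+1.
Local Notation X := (lebesgue_rV R n).
Implicit Types (K Omega : V -> R) (b f : X -> R) (x : X).

Definition enorm (x : V) : R := Num.sqrt (\sum_i x ord0 i ^+ 2).

(* \int_(S^(n.+1 - 1)) g dsigma, where
   sigma(A) = n.+1 * |{r *: u : 0 < r < 1, u \in A}| is surface measure. *)
Definition sphere_integral (g : V -> R) : R :=
  n.+1%:R *
  \int[leb]_(x in [set x : X | 0 < enorm x < 1]) g ((enorm x)^-1 *: (x : V)).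

(* Omega is a function on R^(n.+1) \ {0}: its value at 0 is never constrained,
   nor used in the integrals below. *)
Record admissible_symbol Omega : Prop := AdmissibleSymbol {
  symbol_odd : forall x : V, x != 0 -> Omega (- x) = - Omega x ;
  symbol_homogeneous : forall (r : R) (x : V),
    0 < r -> x != 0 -> Omega (r *: x) = Omega x ;
  symbol_lipschitz : exists L : R, forall u v : V, enorm u = 1 -> enorm v = 1 ->
    `|Omega u - Omega v| <= L * enorm (u - v) ;
  symbol_mean0 : sphere_integral Omega = 0 ;
  symbol_zeros_null : leb [set x : X | (x : V) != 0 /\ Omega x = 0] = 0%E }.

Definition homogeneous_kernel Omega : V -> R :=
  fun z => Omega z / enorm z ^+ n.+1.

Definition riesz_kernel (j : 'I_n.+1) : V -> R :=
  fun z => z ord0 j / enorm z ^+ n.+2.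

Definition truncated_integral K f x (eps : R) : R :=
  \int[leb]_(y in [set y : X | eps < enorm ((x : V) - (y : V))])
     (K ((x : V) - (y : V)) * f y).

Definition pv_exists K f x : Prop :=
  cvg (truncated_integral K f x eps @[eps --> 0^'+]).

Definition pv_operator K f x : R :=
  lim (truncated_integral K f x eps @[eps --> 0^'+]).

Definition commutator_defined K b f x : Prop :=
  pv_exists K (b \* f) x /\ pv_exists K f x.

Definition commutator K b f x : R :=
  pv_operator K (b \* f) x - b x * pv_operator K f x.

Definition loc_integrable b : Prop :=
  measurable_fun setT b /\
  forall C : set V, compact C -> (\int[leb]_(x in (C : set X)) `|b x|%:E < +oo)%E.

Definition bounded_compact_support f : Prop :=
  [/\ measurable_fun setT f,
      exists M : R, forall x, `|f x| <= M &
      compact (closure [set x : V | f x != 0])].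

(* At t = 0 the library has ln 0 = 0, so that logp 0 = 0. *)
Definition logp (t : R) : R := Num.max (ln t) 0.

Definition cube (a : V) (l : R) : set X :=
  [set x | forall i, a ord0 i <= (x : V) ord0 i <= a ord0 i + l].

Definition cube_mean b (Q : set X) : R :=
  (fine (leb Q))^-1 * \int[leb]_(x in Q) b x.

Definition mean_oscillation b (Q : set X) : \bar R :=
  (((fine (leb Q))^-1)%:E * \int[leb]_(x in Q) `|b x - cube_mean b Q|%:E)%E.

Definition BMO b : Prop :=
  loc_integrable b /\
  (ereal_sup [set mean_oscillation b (cube q.1 q.2)
             | q in [set q : V * R | (0 < q.2)%R]] < +oo)%E.

End commutators.

(* Main.v *)
(* For a cube [Q] of side [l] choose a translate [Q'] of [Q] at distance
   comparable to [l], in a direction where [Omega > 0]; then [K (x - y)] is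
   comparable to [l^-d] for [x] in [Q'] and [y] in [Q].  Let [m] be a median of
   [b] on [Q'] and [f] the indicator of [{y in Q | b y > m}].  At every [x] in
   [Q'] with [b x <= m],
     [b, T] f (x) = int_Q K (x - y) (b y - b x) f y dy >= c l^-d int_Q (b - m)^+,
   and no principal value is involved since [x] is away from [Q].  Such [x] fill
   half of [Q'], so the endpoint bound at the level [t = c l^-d int_Q (b - m)^+ / 2]
   forces [t] to be bounded.  Symmetrically for [(b - m)^-]. *)

Require Import Defs.
From HB Require Import structures.
From mathcomp Require Import all_boot all_order all_algebra.
From mathcomp Require Import all_classical all_reals all_analysis.
From mathcomp Require Import measurable_realfun ring lra.
Import Order.TTheory GRing.Theory Num.Theory.
Import numFieldNormedType.Exports.
Local Open Scope classical_set_scope.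
Local Open Scope ring_scope.

(** A large share of the work concerns the measure itself: [leb] comes from the Caratheodory
    construction over covers by half-open boxes, so volumes of boxes, measurability of open sets and
    invariance under reflections are all read off from covers. For cubes the bounds l^d <= |Q| <=
    (2l)^d suffice. The logarithm does no harm because [f] is an indicator tested at a high level:
    once u = B / t <= 1, the right-hand side is just u |F|. Both signs of b - m use the same
    translate Q' and the same positive kernel values: a factor [s] = 1 or -1 multiplies the
    commutator instead. One median serves both, since {b <= m} and {b >= m} each fill at least half
    of Q'. *)

(** * Countable covers of a box by boxes *)

Section box_volume.
Context {R : realType}.

(* Slicing at a value [s] of the last coordinate multiplies the weight of the
   [k]-th box by the indicator of its last side at [s]; integrating the induction
   hypothesis over [s] needs only Lebesgue measure on the line. *)
Lemma le_box_cover_weighted (d : nat) (a b : nat -> R) (lo hi : nat -> nat -> R)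
    (w : nat -> R) (c : R) :
  (forall k, 0 <= w k) -> 0 <= c -> (forall i, (i < d)%N -> a i <= b i) ->
  (forall x : nat -> R, (forall i, (i < d)%N -> a i <= x i < b i) ->
    (c%:E <= \sum_(k <oo)
      (w k * \prod_(i < d) \1_(`[lo k i, hi k i[%classic) (x i))%:E)%E) ->
  ((c * \prod_(i < d) (b i - a i))%:E <=
   \sum_(k <oo) (w k * \prod_(i < d) Num.max (hi k i - lo k i) 0)%:E)%E.
Proof.
elim: d w c => [|d IH] w c w0 c0 ab cov.
  have := cov a; rewrite !big_ord0 mulr1.
  under [in X in X -> _]eq_eseriesr do rewrite big_ord0.
  under [in X in _ -> X]eq_eseriesr do rewrite big_ord0.
  by apply => i; rewrite ltn0.
rewrite big_ord_recr /=.
under eq_eseriesr do rewrite big_ord_recr /=.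
pose P k := \prod_(i < d) Num.max (hi k i - lo k i) 0.
have P0 k : 0 <= P k by apply: prodr_ge0 => i _; rewrite le_max lexx orbT.
pose I k : set (measurableTypeR R) := `[lo k d, hi k d[%classic.
have slice s : a d <= s < b d ->
  ((c * \prod_(i < d) (b i - a i))%:E <=
    \sum_(k <oo) (w k * P k)%:E * (\1_(I k) s)%:E)%E.
  move=> sab; have -> : (\sum_(k <oo) (w k * P k)%:E * (\1_(I k) s)%:E =
      \sum_(k <oo) (w k * \1_(I k) s * P k)%:E)%E.
    by apply: eq_eseriesr => k _; rewrite -EFinM mulrAC.
  apply: IH => // [k|i id|x xab]; first by rewrite mulr_ge0.
    by apply: ab; exact: ltnW.
  apply: (le_trans (cov (fun i => if i == d then s else x i) _)) => [i|].
    by rewrite ltnS leq_eqVlt; case: eqP => [->//|/= _]; exact: xab.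
  rewrite le_eqVlt; apply/orP; left; apply/eqP/eq_eseriesr => k _; congr EFin.
  rewrite big_ord_recr /= eqxx -mulrA; congr (_ * _); rewrite mulrC.
  by congr (_ * _); apply: eq_bigr => i _; rewrite (ltn_eqF (ltn_ord i)).
pose mu := @lebesgue_measure R.
pose D : set (measurableTypeR R) := `[a d, b d[%classic.
have mD : measurable D by exact: measurable_itv.
have mI k : measurable (I k) by exact: measurable_itv.
have itvE (u v : R) : mu `[u, v[%classic = (Num.max (v - u) 0)%:E.
  rewrite /mu lebesgue_measure_itv /= lte_fin.
  case: ltP => uv; first by rewrite -EFinB max_l// subr_ge0 ltW.
  by rewrite max_r// subr_le0.
have -> : ((c * (\prod_(i < d) (b i - a i) * (b d - a d)))%:E =
    \int[mu]_(s in D) cst (c * \prod_(i < d) (b i - a i))%:E s)%E.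
  rewrite integral_cst//= -/mu; have -> := itvE (a d) (b d).
  by rewrite -EFinM mulrA max_l// subr_ge0; exact: ab.
apply: (@le_trans _ _
  (\int[mu]_(s in D) \sum_(k <oo) ((w k * P k)%:E * (\1_(I k) s)%:E)))%E.
  apply: ge0_le_integral => //.
  - move=> s _; rewrite lee_fin; apply: mulr_ge0 => //; apply: prodr_ge0 => i _.
    by rewrite subr_ge0 ab// ltnS ltnW.
  - apply: ge0_emeasurable_sum => k.
      by move=> s _ _; rewrite -EFinM lee_fin !mulr_ge0.
    move=> _; apply/measurable_EFinP; apply: measurable_funM => //;
      exact/measurable_indic/mI.
rewrite integral_nneseries//; last 2 first.
- by move=> k; apply/measurable_EFinP; apply: measurable_funM => //;
    exact/measurable_indic/mI.
- by move=> k s _; rewrite -EFinM lee_fin !mulr_ge0.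
apply: lee_nneseries => [k _ _|k _].
  by apply: integral_ge0 => s _; rewrite -EFinM lee_fin !mulr_ge0.
rewrite ge0_integralZl_EFin//; last 2 first.
- by apply/measurable_EFinP; apply: measurable_indic; exact: mI.
- by rewrite mulr_ge0.
rewrite integral_indic// mulrA [X in (_ <= X)%E]EFinM.
apply: lee_wpmul2l; first by rewrite lee_fin mulr_ge0.
by rewrite -itvE; apply: le_measure; rewrite ?inE//; exact: measurableI.
Qed.
End box_volume.

(** Additivity of length when an interval is cut at [c]; with positive parts it also covers empty
    intervals and cuts outside the interval. *)
Lemma positive_part_cut {R : realDomainType} (l h c : R) :
  Num.max (Num.min h c - l) 0 + Num.max (h - Num.max l c) 0 = Num.max (h - l) 0.
Proof.
by case: (leP h c) => hc; case: (leP l c) => lc;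
  repeat (case: leP => ?); lra.
Qed.

(** * Measure of boxes and cubes, measurability of open sets *)

Section lebesgue_boxes.
Context {R : realType} {n : nat}.
Local Notation V := 'rV[R]_n.+1.
Local Notation X := (lebesgue_rV R n).

Lemma box_vol_le_outer (I : V * V) : ((box_vol I)%:E <= lebesgue_outer (box I))%E.
Proof.
apply: le_ereal_inf_tmp => _ [J cov <-].
(* Taking the maximum replaces an inverted side by an empty one of length 0, so that [a] <= [b]
   holds on every side. *)
pose a i := I.1 ord0 (inord i); pose b i := Num.max (a i) (I.2 ord0 (inord i)).
have volE (K : V * V) : box_vol K =
    \prod_(i < n.+1) Num.max (K.2 ord0 (inord i) - K.1 ord0 (inord i)) 0.
  by apply: eq_bigr => i _; rewrite inord_val.
have -> : (box_vol I)%:E = (1 * \prod_(i < n.+1) (b i - a i))%:E.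
  rewrite mul1r volE; congr EFin; apply: eq_bigr => i _.
  by rewrite /b addr_maxl subrr maxC.
pose lo k i := (J k).1 ord0 (inord i); pose hi k i := (J k).2 ord0 (inord i).
have -> : (\sum_(k <oo) (box_vol (J k))%:E =
    \sum_(k <oo) (1 * \prod_(i < n.+1) Num.max (hi k i - lo k i) 0)%:E)%E.
  by apply: eq_eseriesr => k _; rewrite mul1r volE.
apply: le_box_cover_weighted => // [i _|x xab].
  by rewrite /b le_max lexx.
have [k _ xk] : (\bigcup_k box (J k)) (\row_i x i).
  apply: cov => i; rewrite !mxE; have /andP[ax xb] := xab i (ltn_ord i).
  move: ax xb; rewrite /b /a inord_val => -> /=.
  by rewrite lt_max => /orP[|//]; move=> /lt_le_trans h; have := xab i (ltn_ord i);
    rewrite /a inord_val => /andP[/h]; rewrite ltxx.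
(* The one box known to contain the point already contributes 1 to the series. *)
rewrite (@nneseriesD1 _ _ k)//; last first.
  by move=> j _; rewrite lee_fin mul1r prodr_ge0.
rewrite big1 ?mulr1; last first.
  move=> i _; rewrite indicE mem_set//= in_itv /= /lo /hi inord_val.
  by have := xk i; rewrite mxE.
rewrite leeDl// nneseries_ge0// => j _ _.
by rewrite lee_fin mul1r prodr_ge0.
Qed.

Lemma outer_box_le (I : V * V) : (lebesgue_outer (box I) <= (box_vol I)%:E)%E.
Proof.
apply: ereal_inf_lbound; exists (fun k => if k == 0%N then I else (0, 0)).
  by move=> x Ix; exists 0%N.
rewrite (@nneseriesD1 _ _ 0%N)//= ?eseries0 ?adde0//.
  case => // k _ _; rewrite /box_vol big_ord_recl /= subrr maxxx mul0r //.
move=> k _; rewrite lee_fin; case: ifP => _; apply: prodr_ge0 => i _;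
  by rewrite le_max lexx orbT.
Qed.

Lemma outer_box (I : V * V) : lebesgue_outer (box I) = (box_vol I)%:E.
Proof. by apply/eqP; rewrite eq_le outer_box_le box_vol_le_outer. Qed.

Lemma cube_ge (a : V) (l : R) : 0 <= l -> ((l ^+ n.+1)%:E <= leb (cube a l))%E.
Proof.
move=> l0; pose I := (a, \row_i (a ord0 i + l)).
have -> : l ^+ n.+1 = box_vol I.
  rewrite /box_vol (eq_bigr (fun=> l)) ?prodr_const ?card_ord// => i _.
  by rewrite /= mxE addrAC subrr add0r max_l.
rewrite -outer_box; apply: le_lebesgue_outer => x xI i.
by have /andP[-> /ltW] := xI i; rewrite /= mxE.
Qed.

(** A half-open box of twice the side contains the closed faces; the lost factor 2^d only enters the
    final constant. *)
Lemma cube_le (a : V) (l : R) : 0 < l ->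
  (leb (cube a l) <= ((2 * l) ^+ n.+1)%:E)%E.
Proof.
move=> l0; pose I := (a, \row_i (a ord0 i + 2 * l)).
have -> : (2 * l) ^+ n.+1 = box_vol I.
  rewrite /box_vol (eq_bigr (fun=> 2 * l)) ?prodr_const ?card_ord// => i _.
  by rewrite /= mxE addrAC subrr add0r max_l// mulr_ge0// ltW.
rewrite -outer_box; apply: le_lebesgue_outer => x xI i.
have /andP[-> /le_lt_trans->//] := xI i; rewrite /= mxE ltrD2l.
by rewrite mulr_natl mulr2n ltrDl.
Qed.

Lemma box_volD1 (j : 'I_n.+1) (K I : V * V) :
  (forall i, i != j -> K.1 ord0 i = I.1 ord0 i) ->
  (forall i, i != j -> K.2 ord0 i = I.2 ord0 i) ->
  box_vol K = Num.max (K.2 ord0 j - K.1 ord0 j) 0 *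
    \prod_(i | i != j) Num.max (I.2 ord0 i - I.1 ord0 i) 0.
Proof.
move=> K1 K2; rewrite /box_vol (bigD1 j)//=; congr (_ * _).
by apply: eq_bigr => i ij; rewrite K1// K2.
Qed.

(* The two boxes are the pieces of [I] on either side of the hyperplane [x_j = c]. *)
Lemma box_vol_cut (I : V * V) (j : 'I_n.+1) (c : R) :
  box_vol (I.1, \row_i (if i == j then Num.min (I.2 ord0 i) c else I.2 ord0 i)) +
  box_vol (\row_i (if i == j then Num.max (I.1 ord0 i) c else I.1 ord0 i), I.2) =
  box_vol I.
Proof.
rewrite !(@box_volD1 j _ I)/=; do ?[by []|by move=> i /negbTE ij; rewrite mxE ij].
rewrite -mulrDl !mxE eqxx; congr (_ * _).
exact: positive_part_cut.
Qed.

(** Caratheodory's criterion: the hyperplane cuts each box of a cover of the test set into two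
    half-open boxes of the same total volume, and the pieces cover the two parts of the test set. *)
Lemma measurable_lt_coord (j : 'I_n.+1) (c : R) :
  measurable [set x : X | (x : V) ord0 j < c].
Proof.
apply: le_caratheodory_measurable => A.
apply: le_ereal_inf_tmp => _ [I cov <-].
pose I1 k := ((I k).1,
  \row_i (if i == j then Num.min ((I k).2 ord0 i) c else (I k).2 ord0 i)).
pose I2 k := (\row_i (if i == j then Num.max ((I k).1 ord0 i) c else (I k).1 ord0 i),
  (I k).2).
have -> : (\sum_(k <oo) (box_vol (I k))%:E =
    \sum_(k <oo) (box_vol (I1 k))%:E + \sum_(k <oo) (box_vol (I2 k))%:E)%E.
  rewrite -nneseriesD => [|k _ _|k _ _]; [|exact: box_vol_ge0..].
  by apply: eq_eseriesr => k _; rewrite -EFinD box_vol_cut.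
apply: leeD; apply: ereal_inf_lbound.
- exists I1 => // x [Ax /= xc]; have [k _ xk] := cov _ Ax; exists k => // i.
  rewrite /I1 /= mxE; have /andP[-> xi] := xk i; case: eqP => //= ij.
  by rewrite lt_min xi ij.
- exists I2 => // x [Ax /= /negP xc]; have [k _ xk] := cov _ Ax; exists k => // i.
  rewrite /I2 /= mxE; have /andP[xi ->] := xk i; rewrite andbT; case: eqP => //= ij.
  by rewrite ge_max xi ij leNgt.
Qed.

Lemma measurable_coord (j : 'I_n.+1) :
  measurable_fun setT (fun x : X => (x : V) ord0 j).
Proof.
move=> mT; apply: (measurability _ (RGenInftyO.measurableE R)) => //.
move=> _ [_ [c ->] <-]; rewrite setTI.
rewrite [X in measurable X](_ : _ = [set x : X | (x : V) ord0 j < c]).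
  exact: measurable_lt_coord.
by apply/seteqP; split => x /=; rewrite in_itv.
Qed.

Lemma measurable_cube (a : V) (l : R) : measurable (cube a l : set X).
Proof.
have -> : cube a l =
    \bigcap_(i in [set: 'I_n.+1]) ((fun x : X => (x : V) ord0 i) @^-1`
      `[a ord0 i, a ord0 i + l]%classic).
  by apply/seteqP; split => x /= h i; have := h i; rewrite /= in_itv//=; apply.
apply: fin_bigcap_measurable => // i _; rewrite -[X in measurable X]setTI.
exact: measurable_coord.
Qed.

Lemma open_measurable_lebesgue (U : set V) : open U -> measurable (U : set X).
Proof.
move=> oU.
(* Open cubes with rational centre and radius. [U] is the union of those it contains; [F] enumerates
   them through [unpickle], with the empty set at all other indices. *)
pose C (q : 'rV[rat]_n.+1) (r : rat) : set X :=
  \bigcap_(i in [set: 'I_n.+1]) ((fun x : X => (x : V) ord0 i) @^-1`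
      `](ratr (q ord0 i - r)), (ratr (q ord0 i + r))[%classic).
pose F (k : nat) : set X := if unpickle k is Some (q, r) then
  (if `[< C q r `<=` U >] then C q r else set0) else set0.
have -> : U = \bigcup_k F k.
  apply/seteqP; split=> [x Ux|x [k _]]; last first.
    rewrite /F; case: unpickle => [[q r]|//]; case: ifPn => // /asboolP qrU.
    exact: qrU.
  have /nbhs_ballP[e /= e0 xeU] : nbhs x U by exact: open_nbhs_nbhs.
  have e20 : 0 < e / 2 by rewrite divr_gt0.
  have [r] := rat_in_itvoo e20; rewrite in_itv /= => /andP[r0 re].
  have [q xq] : exists q : 'rV[rat]_n.+1,
      forall i, `|ratr (q ord0 i) - x ord0 i| < ratr r.
    have /choice[q Pq] : forall i, exists q : rat, `|ratr q - x ord0 i| < ratr r :> R.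
      move=> i; have /rat_in_itvoo[q] : x ord0 i - ratr r < x ord0 i + ratr r.
        by rewrite ltrD2l gtrN.
      by rewrite in_itv /= => h; exists q; rewrite ltr_distl.
    by exists (\row_i q i) => i; rewrite mxE.
  have CE y : C q r y = forall i, `|y ord0 i - ratr (q ord0 i)| < ratr r.
    rewrite propeqE; split=> h i; have := h i; rewrite /= in_itv/= rmorphB rmorphD.
      by move=> /(_ I); rewrite ltr_distl.
    by rewrite ltr_distl.
  have CU : C q r `<=` U.
    move=> y; rewrite CE => yC; apply: xeU; split => // i j.
    rewrite !ord1 /ball/= (splitr e) -[x _ _](subrK (ratr (q ord0 j))) -addrA.
    rewrite (le_lt_trans (ler_normD _ _))// ltrD//.
      by rewrite distrC (lt_trans (xq _)).
    by rewrite distrC (lt_trans (yC _)).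
  exists (pickle (q, r)) => //; rewrite /F pickleK.
  by rewrite asboolT// CE => i; rewrite distrC.
apply: bigcup_measurable => k _; rewrite /F.
case: unpickle => [[q r]|//]; case: ifP => // _.
apply: fin_bigcap_measurable => // i _; rewrite -[X in measurable X]setTI.
exact: measurable_coord.
Qed.

End lebesgue_boxes.

(** * The Euclidean norm and its comparison with the sup norm *)

Section euclidean_norm.
Context {R : realType} {n : nat}.
Local Notation V := 'rV[R]_n.+1.
Implicit Types x y : V.

Lemma enorm_sqr x : enorm x ^+ 2 = \sum_i x ord0 i ^+ 2.
Proof. by rewrite sqr_sqrtr// sumr_ge0// => i _; exact: sqr_ge0. Qed.

Lemma enorm_ge0 x : 0 <= enorm x. Proof. exact: sqrtr_ge0. Qed.

Lemma coord_le_enorm x i : `|x ord0 i| <= enorm x.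
Proof.
rewrite -sqrtr_sqr ler_wsqrtr// (bigD1 i)//= lerDl sumr_ge0// => j _.
exact: sqr_ge0.
Qed.

Lemma enorm_eq0 x : (enorm x == 0) = (x == 0).
Proof.
apply/eqP/eqP => [x0|->]; last first.
  by rewrite /enorm big1 ?sqrtr0// => i _; rewrite mxE expr0n.
apply/rowP => i; rewrite mxE; apply/eqP.
by rewrite -normr_le0 -x0 coord_le_enorm.
Qed.

Lemma enorm_gt0 x : (0 < enorm x) = (x != 0).
Proof. by rewrite lt0r enorm_ge0 andbT enorm_eq0. Qed.

Lemma enormZ r x : enorm (r *: x) = `|r| * enorm x.
Proof.
rewrite /enorm -sqrtr_sqr -sqrtrM ?sqr_ge0// mulr_sumr; congr Num.sqrt.
by apply: eq_bigr => i _; rewrite mxE exprMn.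
Qed.

Lemma enormN x : enorm (- x) = enorm x.
Proof. by rewrite -scaleN1r enormZ normrN1 mul1r. Qed.

Lemma enorm_normalize x : x != 0 -> enorm ((enorm x)^-1 *: x) = 1.
Proof.
by move=> x0; rewrite enormZ ger0_norm ?invr_ge0 ?enorm_ge0// mulVf// enorm_eq0.
Qed.

Lemma enormD x y : enorm (x + y) <= enorm x + enorm y.
Proof.
have [->|x0] := eqVneq x 0; first by rewrite add0r lerDr enorm_ge0.
have [->|y0] := eqVneq y 0; first by rewrite addr0 lerDl enorm_ge0.
move: x0 y0; rewrite -!enorm_gt0 => p0 q0.
set p := enorm x in p0 *; set q := enorm y in q0 *.
rewrite -(@ler_pXn2r _ 2) ?nnegrE ?enorm_ge0 ?addr_ge0 ?enorm_ge0//.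
(* the weights q/p and p/q make the coordinatewise AM-GM bound sharp *)
have -> : (p + q) ^+ 2 = (1 + q / p) * p ^+ 2 + (1 + p / q) * q ^+ 2.
  by field; rewrite !gt_eqF.
rewrite !enorm_sqr !mulr_sumr -big_split; apply: ler_sum => i _ /=.
rewrite mxE; set a := x _ _; set b := y _ _.
rewrite -subr_ge0 [leRHS](_ : _ = (q * a - p * b) ^+ 2 / (p * q)); last first.
  by field; rewrite !gt_eqF.
by rewrite divr_ge0 ?sqr_ge0// mulr_ge0// ltW.
Qed.

Lemma enormB x y : enorm (x - y) = enorm (y - x).
Proof. by rewrite -enormN opprB. Qed.

Lemma le_dist_enorm x y : `|enorm x - enorm y| <= enorm (x - y).
Proof.
have le_sub (u v : V) : enorm u - enorm v <= enorm (u - v).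
  by rewrite lerBlDr; have := enormD (u - v) v; rewrite subrK.
by rewrite ler_norml lerNl opprB le_sub enormB le_sub.
Qed.

Lemma enorm_le_sup x c : (forall i, `|x ord0 i| <= c) -> enorm x <= n.+1%:R * c.
Proof.
move=> xc; have c0 : 0 <= c by rewrite (le_trans _ (xc ord0)).
rewrite -(@ler_pXn2r _ 2) ?nnegrE ?enorm_ge0 ?mulr_ge0// enorm_sqr.
apply: (@le_trans _ _ (\sum_(i < n.+1) c ^+ 2)).
  by apply: ler_sum => i _; rewrite -real_normK ?num_real// ler_pXn2r ?nnegrE.
rewrite sumr_const card_ord exprMn -[leLHS]mulr_natl ler_wpM2r ?sqr_ge0//.
by rewrite -natrX ler_nat expnS leq_pmulr.
Qed.

(** One copy of |x - y| / |y| pays for changing the normalizing factor, the other for moving the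
    vector. *)
Lemma enorm_normalize_dist x y : x != 0 -> y != 0 ->
  enorm ((enorm x)^-1 *: x - (enorm y)^-1 *: y) <= 2 * enorm (x - y) / enorm y.
Proof.
rewrite -!enorm_gt0 => x0 y0.
have -> : (enorm x)^-1 *: x - (enorm y)^-1 *: y =
    ((enorm x)^-1 - (enorm y)^-1) *: x + (enorm y)^-1 *: (x - y).
  by rewrite scalerBl scalerBr addrA subrK.
apply: (le_trans (enormD _ _)); rewrite !enormZ.
have -> : (enorm x)^-1 - (enorm y)^-1 = (enorm y - enorm x) / (enorm x * enorm y).
  by field; rewrite !gt_eqF.
rewrite normrM !normfV normrM !(ger0_norm (enorm_ge0 _)) mulr_natl mulr2n mulrDl.
apply: lerD; last by rewrite mulrC.
have -> : `|enorm y - enorm x| / (enorm x * enorm y) * enorm x =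
    `|enorm y - enorm x| / enorm y by field; rewrite !gt_eqF.
by rewrite ler_wpM2r ?invr_ge0 ?enorm_ge0// enormB le_dist_enorm.
Qed.

Lemma enorm_le_norm x : enorm x <= n.+1%:R * `|x|.
Proof.
apply: enorm_le_sup => i; rewrite [leRHS]/Num.norm/= mx_normrE.
exact: (le_bigmax _ (fun ij : 'I_1 * 'I_n.+1 => `|x ij.1 ij.2|) (ord0, i)).
Qed.

(** Passes from Euclidean estimates to the topology, which is defined by the sup norm. *)
Lemma enorm_lipschitz_continuous (f : V -> R) x (C : R) :
  (\forall y \near x, `|f x - f y| <= C * enorm (x - y)) ->
  {for x, continuous f}.
Proof.
move=> fC; apply/(@cvgrPdist_le _ _ _ (nbhs x) _ f (f x)) => e e0.
(* The added 1 keeps [K] positive when [C] is 0, so that one can divide by it. *)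
pose K := `|C| * n.+1%:R + 1.
have K0 : 0 < K by rewrite ltr_wpDl// mulr_ge0.
near=> y; have fy : `|f x - f y| <= C * enorm (x - y) by near: y.
apply: (le_trans fy); apply: (@le_trans _ _ (K * `|x - y|)).
  apply: (@le_trans _ _ (`|C| * enorm (x - y))).
    by rewrite ler_wpM2r ?enorm_ge0// ler_norm.
  rewrite mulrDl mul1r -mulrA ler_wpDr//.
  by rewrite ler_wpM2l// enorm_le_norm.
rewrite mulrC -ler_pdivlMr//; near: y.
apply: cvgr_dist_le; first exact: cvg_id.
exact: divr_gt0.
Unshelve. all: by end_near. Qed.

Lemma enorm_continuous : continuous (@enorm R n).
Proof.
move=> x; apply: (@enorm_lipschitz_continuous _ _ 1); near=> y.
by rewrite mul1r le_dist_enorm.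
Unshelve. all: by end_near. Qed.

Lemma open_nonzero : open [set x : V | x != 0].
Proof.
rewrite (_ : mkset _ = @enorm R n @^-1` `]0, +oo[%classic).
  by apply: open_comp => // x _; exact: enorm_continuous.
by apply/seteqP; split => x; rewrite /= in_itv/= andbT enorm_gt0.
Qed.

(** Continuity is asked only at points of [D] because the functions in view are singular at one
    point. *)
Lemma continuous_open_measurable (D : set V) (f : V -> R) : open D ->
  (forall x, D x -> {for x, continuous f}) ->
  measurable_fun (D : set (lebesgue_rV R n)) f.
Proof.
move=> oD cf mD; apply: (measurability _ (RGenInftyO.measurableE R)) => //.
move=> _ [_ [c ->] <-]; apply: open_measurable_lebesgue.
rewrite openE => x [Dx]; rewrite /= in_itv /= => fxc.
apply: filterI; first exact: open_nbhs_nbhs.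
apply: filterS (cvgr_lt _ (cf x Dx) _ fxc) => y /=; by rewrite in_itv.
Qed.

End euclidean_norm.

(** * Null hyperplanes and integrals of functions odd in one coordinate *)

Section hyperplane_reflection.
Context {R : realType} {n : nat}.
Local Notation V := 'rV[R]_n.+1.
Local Notation X := (lebesgue_rV R n).

Lemma hyperplane_null (j : 'I_n.+1) : leb [set x : X | (x : V) ord0 j = 0] = 0%E.
Proof.
pose H (N : nat) : set V :=
  [set x | x ord0 j = 0 /\ forall i, - N%:R <= x ord0 i < N%:R].
have H0 N : lebesgue_outer (H N) = 0%E.
  apply/eqP; rewrite eq_le lebesgue_outer_ge0 andbT; apply/lee_addgt0Pr => e e0.
  (* [H N] fits in a box with n sides of length 2N and thickness e / K, whose volume is at most e.
     The added 1 keeps [K] positive also when N = 0. *)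
  rewrite add0e; pose K : R := (N%:R + N%:R) ^+ n + 1.
  have K0 : 0 < K by rewrite ltr_wpDl// exprn_ge0// addr_ge0.
  pose I : V * V := (\row_i (if i == j then 0 else - N%:R),
                     \row_i (if i == j then e / K else N%:R)).
  apply: (@le_trans _ _ (lebesgue_outer (box I))).
    apply: le_lebesgue_outer => x [xj xN] i; rewrite /= !mxE.
    by case: eqP => [->|_]; [rewrite xj lexx divr_gt0|exact: xN].
  rewrite outer_box lee_fin /box_vol (bigD1 j)//= !mxE eqxx subr0.
  rewrite max_l; last by rewrite divr_ge0// ltW.
  rewrite (eq_bigr (fun=> N%:R + N%:R)); last first.
    by move=> i /negbTE ij; rewrite !mxE ij opprK max_l// addr_ge0.
  rewrite prodr_const cardC1 card_ord/=. rewrite mulrAC ler_pdivrMr// ler_pM2l//.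
  by rewrite /K lerDl.
apply/eqP; rewrite eq_le lebesgue_outer_ge0 andbT.
apply: (@le_trans _ _ (lebesgue_outer (\bigcup_N H N))).
  apply: le_lebesgue_outer => x /= xj.
  exists (Num.truncn (enorm x)).+1 => //; split=> // i.
  have := le_lt_trans (coord_le_enorm x i) (truncnS_gt _).
  by rewrite ltr_norml => /andP[/ltW -> ->].
apply: (le_trans (lebesgue_outer_sigma_subadditive H)).
by rewrite eseries0.
Qed.

Definition reflect (j : 'I_n.+1) (x : V) : V :=
  \row_i (if i == j then - x ord0 i else x ord0 i).

Lemma reflectK j : involutive (reflect j).
Proof.
by move=> x; apply/rowP => i; rewrite !mxE; case: (i == j); rewrite ?opprK.
Qed.

Lemma enorm_reflect j x : enorm (reflect j x) = enorm x.
Proof.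
by congr Num.sqrt; apply: eq_bigr => i _; rewrite mxE; case: ifP; rewrite ?sqrrN.
Qed.

Lemma outer_preimage_reflect_le j (A : set V) :
  (lebesgue_outer (reflect j @^-1` A) <= lebesgue_outer A)%E.
Proof.
apply: le_ereal_inf_tmp => _ [I cov <-].
apply/lee_mul01Pr => [|r /andP[r0 r1]]; first exact: lebesgue_outer_ge0.
(* reflecting flips the half-open side, so the boxes have to be enlarged a little *)
pose J k : V * V := (\row_i (if i == j then - (I k).2 ord0 i else (I k).1 ord0 i),
  \row_i (if i == j then r^-1 * ((I k).2 ord0 i - (I k).1 ord0 i) - (I k).2 ord0 i
          else (I k).2 ord0 i)).
have volJ k : r * box_vol (J k) = box_vol (I k).
  rewrite !(@box_volD1 _ _ j _ (I k))/=;
    do ?[by []|by move=> i /negbTE ij; rewrite mxE ij].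
  rewrite !mxE eqxx opprK subrK mulrA; congr (_ * _).
  by rewrite maxr_pMr ?ltW// mulr0 mulrA divff ?mul1r// gt_eqF.
have -> : (\sum_(k <oo) (box_vol (I k))%:E =
    r%:E * \sum_(k <oo) (box_vol (J k))%:E)%E.
  rewrite -nneseriesZl; last by move=> k _; exact: box_vol_ge0.
  by apply: eq_eseriesr => k _; rewrite -EFinM volJ.
apply: lee_wpmul2l; first by rewrite lee_fin ltW.
apply: ereal_inf_lbound; exists J => // x /cov[k _ xk]; exists k => // i.
have := xk i; rewrite /= !mxE; case: eqP => // _ /andP[lx xh].
rewrite lerNl ltW//= ltrBrDr.
have hl : 0 < (I k).2 ord0 i - (I k).1 ord0 i.
  by rewrite subr_gt0 (le_lt_trans lx).
rewrite (@le_lt_trans _ _ ((I k).2 ord0 i - (I k).1 ord0 i))//.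
  by rewrite addrC lerD2l lerNr.
by rewrite ltr_pMl// invf_gt1.
Qed.

Lemma outer_preimage_reflect j (A : set V) :
  lebesgue_outer (reflect j @^-1` A) = lebesgue_outer A.
Proof.
apply/eqP; rewrite eq_le outer_preimage_reflect_le/=.
have {1}-> : A = reflect j @^-1` (reflect j @^-1` A).
  by apply/seteqP; split => x /=; rewrite reflectK.
exact: outer_preimage_reflect_le.
Qed.

(** By invariance of the outer measure, testing the preimage of [S] against [A] amounts to testing
    [S] against the preimage of [A]. *)
Lemma measurable_reflect j : measurable_fun setT (reflect j : X -> X).
Proof.
move=> _ S mS; rewrite setTI.
have mS' : (lebesgue_outer_measure R n).-caratheodory S := mS.
suff : (lebesgue_outer_measure R n).-caratheodory (reflect j @^-1` S) by [].
have preI (A B : set V) : lebesgue_outer (A `&` reflect j @^-1` B) =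
    lebesgue_outer (reflect j @^-1` A `&` B).
  rewrite -(outer_preimage_reflect j); congr lebesgue_outer.
  by apply/seteqP; split => x; rewrite /= reflectK.
move=> A; apply: etrans (esym (outer_preimage_reflect j A)) _.
apply: etrans (mS' _) _.
by congr adde; apply: esym; exact: preI.
Qed.

Lemma Rintegral_reflect_odd j (D : set X) (g : X -> R) :
  measurable D -> (forall x : V, D (reflect j x) <-> D x) ->
  measurable_fun D g -> (forall x : V, D x -> g (reflect j x) = - g x) ->
  \int[leb]_(x in D) g x = 0.
Proof.
move=> mD DE mg godd; rewrite /Rintegral integralE.
suff -> : (\int[leb]_(x in D) (EFin \o g)^\- x =
           \int[leb]_(x in D) (EFin \o g)^\+ x)%E.
  (* If both parts are infinite, their difference is an infinite value, which [fine] sends to 0. *)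
  by case: integral => [r| |] //=; rewrite subrr.
have preD : (reflect j : X -> X) @^-1` D = D by rewrite predeqE => x; exact: DE.
transitivity (\int[leb]_(x in D) ((EFin \o g)^\+ \o (reflect j : X -> X)) x)%E.
  apply: eq_integral => x /set_mem Dx.
  by rewrite /= funeposE funenegE /= godd.
rewrite -[in LHS]preD -(ge0_integral_pushforward (measurable_reflect j))//.
- apply: eq_measure_integral; first exact: measurable_reflect.
  by move=> mr A _ _; exact: outer_preimage_reflect.
- exact/measurable_funepos/measurable_EFinP.
Qed.

End hyperplane_reflection.

(** * Riesz transforms as instances *)

Section riesz.
Context {R : realType} {n : nat}.
Local Notation V := 'rV[R]_n.+1.
Local Notation X := (lebesgue_rV R n).

(** Reflecting the j-th coordinate preserves the punctured ball and flips the sign of the symbol,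
    hence mean zero; the zeros lie in the hyperplane x_j = 0. *)
Lemma riesz_symbol_admissible (j : 'I_n.+1) :
  admissible_symbol (fun x : V => x ord0 j / enorm x).
Proof.
split=> [x _|r x r0 x0||| ].
- by rewrite mxE enormN mulNr.
- rewrite mxE enormZ gtr0_norm// -mulf_div divff ?mul1r// gt_eqF//.
- exists 1 => u v u1 v1; rewrite u1 v1 !divr1 mul1r.
  by have := coord_le_enorm (u - v) j; rewrite !mxE.
- apply: etrans (mulr0 _); congr (_ * _).
  apply: (@Rintegral_reflect_odd _ _ j).
  + apply: open_measurable_lebesgue.
    rewrite (_ : mkset _ = @enorm R n @^-1` `]0, 1[%classic); last first.
      by apply/seteqP; split => x; rewrite /= in_itv.
    by apply: open_comp => // x _; exact: enorm_continuous.
  + by move=> x /=; rewrite enorm_reflect.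
  + apply: (@eq_measurable_fun _ _ _ _ _ (fun x : X => (x : V) ord0 j / enorm x)).
      move=> x /set_mem /= /andP[x0 _].
      rewrite enorm_normalize -?enorm_gt0// divr1 mxE mulrC//.
    apply: (@measurable_funS _ _ X _ ([set x : V | x != 0] : set X)).
    * by apply: open_measurable_lebesgue; exact: open_nonzero.
    * by move=> x /= /andP[x0 _]; rewrite -enorm_gt0.
    * apply: continuous_open_measurable; first exact: open_nonzero.
      move=> x /= x0.
      apply: (@cvgM _ _ (nbhs x) _ (fun y : V => y ord0 j) (fun y => (enorm y)^-1)).
        exact: coord_continuous.
      by apply: cvgV; [rewrite enorm_eq0|exact: enorm_continuous].
  + move=> x _; rewrite enorm_reflect !enormZ enorm_reflect !mxE eqxx.
    by rewrite mulrN mulNr.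
- apply/eqP; rewrite eq_le measure_ge0 andbT -(hyperplane_null j).
  apply: le_lebesgue_outer => x /= [x0 /eqP].
  by rewrite mulf_eq0 invr_eq0 enorm_eq0 (negbTE x0) orbF => /eqP.
Qed.

(** The equality includes z = 0, where both sides are 0 because the inverse of 0 is 0. *)
Lemma homogeneous_kernel_riesz (j : 'I_n.+1) :
  homogeneous_kernel (fun x : V => x ord0 j / enorm x) = riesz_kernel j.
Proof.
by apply/funext => z; rewrite /homogeneous_kernel /riesz_kernel -mulrA -invfM -exprS.
Qed.

End riesz.

(** * Medians on a set of finite measure *)

Section median.
Local Open Scope ereal_scope.
Context {d : measure_display} {T : measurableType d} {R : realType}.
Variable mu : {measure set T -> \bar R}.

Lemma measure_bigcup_le (F : (set T)^nat) (c : \bar R) :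
  (forall k, measurable (F k)) -> nondecreasing_seq F ->
  (forall k, mu (F k) <= c) -> mu (\bigcup_k F k) <= c.
Proof.
move=> mF ndF Fc.
have cv := nondecreasing_cvg_mu mF (bigcup_measurable (fun k _ => mF k)) ndF.
by apply: (cvge_le _ (cv _ mu)); apply: nearW => k; exact: Fc.
Qed.

(** The witness is the supremum of the levels a with mu {b < a} <= m / 2. There {b < a} is an
    increasing union over levels below it and {b > a} one over levels above it, so both have at most
    half the mass, and their complements at least half. *)
Lemma median_exists (D : set T) (b : T -> R) (m : R) :
  measurable D -> measurable_fun D b -> mu D = m%:E -> (0 < m)%R ->
  exists a : R, (m / 2)%:E <= mu (D `&` [set x | (b x <= a)%R]) /\
                (m / 2)%:E <= mu (D `&` [set x | (a <= b x)%R]).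
Proof.
move=> mD mb muD m0.
pose G a := D `&` [set x | (b x < a)%R].
pose H a := D `&` [set x | (a <= b x)%R].
have mG a : measurable (G a).
  by rewrite /G -preimage_itvNyo; apply: mb => //; exact: measurable_itv.
have mH a : measurable (H a).
  by rewrite /H -preimage_itvcy; apply: mb => //; exact: measurable_itv.
have leG a a' : (a <= a')%R -> mu (G a) <= mu (G a').
  move=> aa'; apply: le_measure; rewrite ?inE// => x [Dx /= xa]; split=> //=.
  exact: lt_le_trans aa'.
have GH a : mu (G a) + mu (H a) = m%:E.
  rewrite -muD -measureU//; last first.
    by rewrite -subset0 => x [[_ /= xa] [_ /=]]; rewrite leNgt xa.
  congr (mu _); apply/seteqP; split => [x [[]|[]]//|x Dx].
  by have [xa|xa] := ltP (b x) a; [left|right].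
have halves g h : 0 <= g -> 0 <= h -> g + h = m%:E ->
    (m / 2)%:E < g -> h <= (m / 2)%:E.
  move: g h => [g| |] [h| |]//= _ _ [gh].
  by rewrite lte_fin lee_fin; lra.
have half a : (m / 2)%:E < mu (G a) -> mu (H a) <= (m / 2)%:E by exact: halves.
have halfH a : (m / 2)%:E < mu (H a) -> mu (G a) <= (m / 2)%:E.
  by apply: halves => //; rewrite addeC.
have m2m : (m / 2)%:E < m%:E by rewrite lte_fin; lra.
pose S := [set a | mu (G a) <= (m / 2)%:E].
have S0 : S !=set0.
  (* If no level qualified, all the sets {b >= -k} would have at most half the mass, yet they
     increase to [D]. *)
  apply/set0P/eqP => S0; suff : mu (\bigcup_k H (- k%:R)%R) <= (m / 2)%:E.
    rewrite (_ : \bigcup_k _ = D) ?muD; first by rewrite leNgt m2m.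
    apply/seteqP; split => [x [k _ []]//|x Dx].
    exists (Num.truncn `|b x|).+1 => //; split=> //=.
    by rewrite lerNl ltW// (le_lt_trans _ (truncnS_gt _))// -normrN ler_norm.
  apply: measure_bigcup_le => // [|k].
    apply/nondecreasing_seqP => k; apply/subsetPset => x [Dx /=]; split => //=.
    by rewrite (le_trans _ (_ : - k%:R <= b x)%R)// lerN2 ler_nat.
  rewrite leNgt; apply/negP => /halfH Sk.
  by have : S (- k%:R)%R by []; rewrite S0.
have [k kS] : exists k : nat, mu (G k%:R) > (m / 2)%:E.
  apply/not_existsP => kS; suff : mu (\bigcup_k G k%:R) <= (m / 2)%:E.
    rewrite (_ : \bigcup_k _ = D) ?muD; first by rewrite leNgt m2m.
    apply/seteqP; split => [x [k _ []]//|x Dx].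
    exists (Num.truncn `|b x|).+1 => //; split=> //=.
    by rewrite (le_lt_trans _ (truncnS_gt _))// ler_norm.
  apply: measure_bigcup_le => // [|k].
    apply/nondecreasing_seqP => k; apply/subsetPset => x [Dx /= xk]; split => //=.
    by rewrite (lt_le_trans xk)// ler_nat.
  by rewrite leNgt; apply/negP/kS.
have Sub : has_ubound S.
  exists k%:R => a Sa; rewrite leNgt; apply/negP => /ltW /leG.
  by rewrite leNgt (le_lt_trans Sa).
have halfC B : measurable (D `&` B) -> mu (D `&` B) <= (m / 2)%:E ->
    (m / 2)%:E <= mu (D `&` ~` B).
  move=> mB; have mC : measurable (D `&` ~` B).
    rewrite (_ : _ `&` _ = D `\` (D `&` B)); first exact: measurableD.
    apply/seteqP; split=> x [Dx h]; split => //; first by case.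
    by move=> Bx; apply: h.
  have : mu (D `&` B) + mu (D `&` ~` B) = m%:E.
    rewrite -muD -measureU//; last by rewrite setIACA setICr setI0.
    by rewrite -setIUr setUCr setIT.
  have := measure_ge0 mu (D `&` B); have := measure_ge0 mu (D `&` ~` B).
  case: (mu (D `&` B)) (mu (D `&` ~` B)) => [g| |] [h| |]//= _ _ [gh].
  by rewrite !lee_fin; lra.
exists (sup S); split; last first.
  rewrite (_ : [set x | _] = ~` [set x | (b x < sup S)%R]); last first.
    by apply/seteqP; split => x /=; rewrite leNgt => /negP.
  apply: halfC; first exact: mG.
  rewrite (_ : _ `&` _ = \bigcup_k G (sup S - k.+1%:R^-1)%R).
    apply: measure_bigcup_le => // [|j].
      apply/nondecreasing_seqP => j; apply/subsetPset => x [Dx /= xk]; split => //=.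
      rewrite (lt_le_trans xk)// lerD2l lerN2 lef_pV2 ?posrE// ler_nat//.
    have [a Sa] := @sup_adherent _ S j.+1%:R^-1 ltac:(by []) (conj S0 Sub).
    by move=> /ltW /leG /le_trans; apply.
  apply/seteqP; split => [x [Dx /= xS]|x [j _ [Dx /= xj]]].
    have [j jx] := ltr_add_invr xS; exists j => //; split=> //=.
    by rewrite ltrBrDr.
  by split => //=; rewrite (lt_le_trans xj)// gerBl.
rewrite (_ : [set x | _] = ~` [set x | (sup S < b x)%R]); last first.
  by apply/seteqP; split => x /=; rewrite leNgt => /negP.
apply: halfC.
  by rewrite -preimage_itvoy; apply: mb => //; exact: measurable_itv.
rewrite (_ : _ `&` _ = \bigcup_k H (sup S + k.+1%:R^-1)%R).
  apply: measure_bigcup_le => // [|j].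
    apply/nondecreasing_seqP => j; apply/subsetPset => x [Dx /= xk]; split => //=.
    rewrite (le_trans _ xk)// lerD2l lef_pV2 ?posrE// ler_nat//.
  apply: half; rewrite ltNge; apply/negP => Sj.
  have := ub_le_sup Sub Sj; rewrite leNgt ltrDl invr_gt0 ltr0n//.
apply/seteqP; split => [x [Dx /= xS]|x [j _ [Dx /= xj]]].
  by have [j jx] := ltr_add_invr xS; exists j => //; split=> //=; exact: ltW.
by split => //=; rewrite (lt_le_trans _ xj)// ltrDl.
Qed.

End median.

Section integrable_EFin.
Context {d : measure_display} {T : measurableType d} {R : realType}.
Variable mu : {measure set T -> \bar R}.

Lemma le_integrable_EFin (D : set T) (f g : T -> R) : measurable D ->
  measurable_fun D f -> (forall y, D y -> `|f y| <= `|g y|) ->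
  mu.-integrable D (EFin \o g) -> mu.-integrable D (EFin \o f).
Proof.
move=> mD mf fg; apply: le_integrable => //; exact/measurable_EFinP.
Qed.

Lemma integrable_EFinZl (D : set T) (r : R) (f : T -> R) : measurable D ->
  mu.-integrable D (EFin \o f) -> mu.-integrable D (EFin \o (fun y => r * f y)).
Proof. by move=> mD /(integrableZl mD r). Qed.

Lemma integrable_EFinB (D : set T) (f g : T -> R) : measurable D ->
  mu.-integrable D (EFin \o f) -> mu.-integrable D (EFin \o g) ->
  mu.-integrable D (EFin \o (fun y => f y - g y)).
Proof. by move=> mD iff /(integrableB mD iff). Qed.

Lemma integrable_EFinD (D : set T) (f g : T -> R) : measurable D ->
  mu.-integrable D (EFin \o f) -> mu.-integrable D (EFin \o g) ->
  mu.-integrable D (EFin \o (fun y => f y + g y)).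
Proof. by move=> mD iff /(integrableD mD iff). Qed.

End integrable_EFin.

(** The factors 1 and -1 are kept so that the two terms match the sign [s] of
    [positive_part_oscillation]. *)
Lemma normr_positive_parts {R : realDomainType} (x : R) :
  `|x| = Num.max (1 * x) 0 + Num.max (-1 * x) 0.
Proof.
rewrite mul1r mulN1r; case/orP: (le_total 0 x) => x0.
  by rewrite ger0_norm// max_l// max_r ?oppr_le0// addr0.
by rewrite ler0_norm// max_r// max_l ?oppr_ge0// add0r.
Qed.

(** * Continuity of the kernel and its size in a cone *)

Section kernel.
Context {R : realType} {n : nat}.
Local Notation V := 'rV[R]_n.+1.
Local Notation X := (lebesgue_rV R n).
Variable Omega : V -> R.
Hypothesis admOmega : admissible_symbol Omega.
Let K := homogeneous_kernel Omega.

Lemma symbol_positive_direction : exists2 u : V, enorm u = 1 & 0 < Omega u.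
Proof.
have [x x0 Ox0] : exists2 x : V, x != 0 & Omega x != 0.
  apply: contrapT => noO.
  (* The unit cube with corner (1, ..., 1) avoids the origin and has positive measure, so a symbol
     vanishing on it would contradict the null zero set. *)
  have := @cube_ge _ _ (const_mx 1 : V) 1 ler01.
  rewrite expr1n leNgt (@le_lt_trans _ _ 0%E)// -(symbol_zeros_null admOmega).
  apply: le_lebesgue_outer => x xQ.
  have x0 : (x : V) != 0.
    apply/eqP => x0; have := xQ ord0; rewrite x0 !mxE => /andP[+ _].
    by rewrite ler10.
  split => //; apply/eqP; apply: contrapT => /negP Ox.
  by apply: noO; exists x.
have pos (y : V) : y != 0 -> 0 < Omega y -> exists2 u : V, enorm u = 1 & 0 < Omega u.
  move=> y0 Oy; exists ((enorm y)^-1 *: y); first exact: enorm_normalize.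
  by rewrite (symbol_homogeneous admOmega)// invr_gt0 enorm_gt0.
have [Oneg|Opos|Oz] := ltgtP (Omega x) 0; last by rewrite Oz eqxx in Ox0.
- apply: (pos (- x)); first by rewrite oppr_eq0.
  by rewrite (symbol_odd admOmega)// oppr_gt0.
- exact: pos Opos.
Qed.

(** By homogeneity both points can be moved to the sphere, at the cost measured by
    [enorm_normalize_dist]. *)
Lemma symbol_relative_lipschitz : exists2 C : R, 0 <= C &
  forall x y : V, x != 0 -> y != 0 ->
    `|Omega x - Omega y| <= C * (enorm (x - y) / enorm y).
Proof.
have [L OL] := symbol_lipschitz admOmega.
exists (`|L| * 2) => [|x y x0 y0]; first by rewrite mulr_ge0.
rewrite -(symbol_homogeneous admOmega (r := (enorm x)^-1) (x := x))//; last first.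
  by rewrite invr_gt0 enorm_gt0.
rewrite -(symbol_homogeneous admOmega (r := (enorm y)^-1) (x := y))//; last first.
  by rewrite invr_gt0 enorm_gt0.
apply: (le_trans (OL _ _ (enorm_normalize _ x0) (enorm_normalize _ y0))).
apply: (le_trans (ler_wpM2r (enorm_ge0 _) (ler_norm L))).
rewrite -mulrA ler_wpM2l// mulrA.
exact: enorm_normalize_dist.
Qed.

Lemma homogeneous_kernel_continuous (x : V) : x != 0 -> {for x, continuous K}.
Proof.
move=> x0; have [C C0 OC] := symbol_relative_lipschitz.
have cO : {for x, continuous Omega}.
  apply: (@enorm_lipschitz_continuous _ _ _ _ (C / enorm x)).
  have : \forall y \near x, (y : V) != 0.
    by apply: open_nbhs_nbhs; split => //; exact: open_nonzero.
  apply: filterS => y y0; rewrite distrC enormB mulrAC -mulrA.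
  exact: OC.
apply: (@cvgM _ _ (nbhs x) _ Omega (fun y => (enorm y ^+ n.+1)^-1)) => //.
apply: cvgV; first by rewrite expf_eq0 enorm_eq0 (negbTE x0).
apply: (continuous_cvg _ (@exprn_continuous _ n.+1 _)).
exact: enorm_continuous.
Qed.

(** Seen from the origin, a cube of size l at distance M l subtends a small angle when M is large,
    so the symbol stays close to its positive value at the centre. Here [z] will be x - y with x in
    Q' and y in Q. *)
Lemma homogeneous_kernel_cone : exists (w : V) (c C : R), 0 < c /\
  forall (l : R) (z : V), 0 < l -> (forall i, `|z ord0 i - l * w ord0 i| <= l) ->
    l <= enorm z /\ c / l ^+ n.+1 <= K z <= C / l ^+ n.+1.
Proof.
have [u u1 Ou] := symbol_positive_direction.
have [C0 C0_ge0 OC] := symbol_relative_lipschitz.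
pose k := Omega u / 2; have k0 : 0 < k by rewrite divr_gt0.
pose d : R := n.+1%:R; have d1 : 1 <= d by rewrite ler1n.
(* The first term keeps |z| >= d l >= l; the second makes the symbol vary by at most k = Omega u /
   2, so that it lies between k and 3k. *)
pose M := 2 * d + C0 * d / k.
have M2d : 2 * d <= M by rewrite lerDl divr_ge0 ?mulr_ge0// ?ltW// (le_trans ler01).
have M0 : 0 < M by lra.
have Md0 : 0 < M + d by lra.
exists (M *: u), (k / (M + d) ^+ n.+1), (3 * k); split.
  by rewrite divr_gt0// exprn_gt0.
move=> l z l0 zl; pose v := (l * M) *: u.
have v0 : enorm v = l * M by rewrite enormZ u1 mulr1 gtr0_norm// mulr_gt0.
have vn0 : v != 0 by rewrite -enorm_gt0 v0 mulr_gt0.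
have zv : enorm (z - v) <= d * l.
  by apply: enorm_le_sup => i; have := zl i; rewrite !mxE mulrA.
have /andP[z1 z2] : l <= enorm z <= l * (M + d).
  have := le_trans (le_dist_enorm z v) zv; rewrite v0 ler_norml.
  nra.
have z0 : z != 0 by rewrite -enorm_gt0 (lt_le_trans l0).
have Ov : Omega v = Omega u.
  rewrite (symbol_homogeneous admOmega) ?mulr_gt0//.
  by rewrite -enorm_gt0 u1.
have /andP[kO Ok] : k <= Omega z <= 3 * k.
  have := OC z v z0 vn0; rewrite Ov v0.
  have : C0 * (enorm (z - v) / (l * M)) <= k.
    rewrite mulrA ler_pdivrMr ?mulr_gt0//.
    apply: (le_trans (ler_wpM2l C0_ge0 zv)).
    have -> : k * (l * M) = k * l * (2 * d) + C0 * (d * l).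
      by rewrite /M; field; rewrite gt_eqF.
    by rewrite lerDr !mulr_ge0// ltW// (lt_le_trans ltr01).
  rewrite ler_norml /k; lra.
have ez : 0 < enorm z by rewrite enorm_gt0.
split => //; rewrite /K /homogeneous_kernel; apply/andP; split.
  rewrite -mulrA -invfM -exprMn; apply: ler_pM => //.
  - exact: ltW.
  - by rewrite invr_ge0 exprn_ge0// mulr_ge0// ltW.
  - rewrite lef_pV2 ?posrE ?exprn_gt0 ?mulr_gt0// mulrC.
    by rewrite ler_pXn2r ?nnegrE ?mulr_ge0// ltW.
apply: ler_pM => //.
- by rewrite (le_trans _ kO)// ltW.
- by rewrite invr_ge0 exprn_ge0// ltW.
- by rewrite lef_pV2 ?posrE ?exprn_gt0// ler_pXn2r ?nnegrE// ltW.
Qed.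

End kernel.

(** * The commutator away from the support *)

Section far_from_support.
Context {R : realType} {n : nat}.
Local Notation V := 'rV[R]_n.+1.
Local Notation X := (lebesgue_rV R n).
Variables (K : V -> R) (Q : set X) (x : V) (delta : R).
Hypothesis delta_gt0 : 0 < delta.
Hypothesis farQ : forall y : V, Q y -> delta <= enorm (x - y).

(** A truncation at eps < [delta] removes nothing from [Q], so the truncated integrals are
    eventually constant. *)
Lemma pv_far (f : X -> R) : (forall y, ~ Q y -> f y = 0) ->
  pv_exists K f x /\
  pv_operator K f x = \int[leb]_(y in Q) (K (x - (y : V)) * f y).
Proof.
move=> f0; set I := (X in _ = X).
have trE : \forall eps \near 0^'+, truncated_integral K f x eps = I.
  near=> eps; have epsd : eps < delta by near: eps; exact: nbhs_right_lt.
  rewrite /truncated_integral /I Rintegral_mkcond [RHS]Rintegral_mkcond.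
  apply: eq_Rintegral => y _; rewrite /patch.
  have [yQ|yQ] := boolP (y \in Q).
    by rewrite mem_set//=; apply: lt_le_trans epsd (farQ _ _); exact: set_mem.
  by case: ifP => // _; rewrite f0 ?mulr0// => /mem_set; rewrite (negbTE yQ).
have cv : truncated_integral K f x eps @[eps --> 0^'+] --> I.
  exact: cvg_near_cst.
by split; [exact: cvgP cv|exact: cvg_lim cv].
Unshelve. all: by end_near. Qed.

Lemma commutator_far (b f : X -> R) : (forall y, ~ Q y -> f y = 0) ->
  commutator_defined K b f x /\
  commutator K b f x = \int[leb]_(y in Q) (K (x - (y : V)) * (b y * f y)) -
                       b x * \int[leb]_(y in Q) (K (x - (y : V)) * f y).
Proof.
move=> f0; have [c1 e1] := pv_far _ f0.
have [|c2 e2] := pv_far (b \* f); first by move=> y /f0 fy; rewrite /= fy mulr0.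
by split; [split|rewrite /commutator e1 e2].
Qed.

End far_from_support.

(** * Integrability and test functions on cubes *)

Section cubes.
Context {R : realType} {n : nat}.
Local Notation V := 'rV[R]_n.+1.
Local Notation X := (lebesgue_rV R n).

Lemma compact_cube (a : V) (l : R) : compact (cube a l : set V).
Proof.
have := @rV_compact R n.+1 (fun i => `[a ord0 i, a ord0 i + l]%classic)
  (fun i => @segment_compact _ _ _).
congr compact; apply/seteqP; split => y yQ i; have := yQ i; rewrite /= in_itv//.
Qed.

Lemma cube_finite (a : V) (l : R) : 0 < l -> (leb (cube a l) < +oo)%E.
Proof. by move=> l0; rewrite (le_lt_trans (cube_le _ _ l0))// ltry. Qed.

Lemma integrable_cst_cube (a : V) (l g : R) : 0 < l ->
  leb.-integrable (cube a l) (EFin \o cst g).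
Proof.
move=> l0; apply/integrableP; split; first exact/measurable_EFinP.
rewrite (eq_integral (cst `|g|%:E))// integral_cst; last exact: measurable_cube.
by rewrite lte_mul_pinfty//; exact: cube_finite.
Qed.

Lemma loc_integrable_cube (b : X -> R) (a : V) (l : R) :
  loc_integrable b -> leb.-integrable (cube a l) (EFin \o b).
Proof.
move=> [mb ib]; apply/integrableP; split.
  by apply/measurable_EFinP; apply: measurable_funTS.
exact: ib (compact_cube a l).
Qed.

Lemma indic_bounded_compact_support (F : set X) (a : V) (l : R) :
  measurable F -> F `<=` cube a l -> bounded_compact_support (\1_F : X -> R).
Proof.
move=> mF FQ; split.
- exact: measurable_indic.
- by exists 1 => x; rewrite indicE; case: (_ \in _); rewrite ?normr1 ?normr0.
- apply: (subclosed_compact _ (compact_cube a l)); first exact: closed_closure.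
  rewrite [Y in _ `<=` Y](closure_id _).1; last first.
    by apply: compact_closed; [exact: norm_hausdorff|exact: compact_cube].
  apply: closure_subset => x /=; rewrite indicE.
  by case: (boolP (x \in F)) => [/set_mem/FQ//|]; rewrite eqxx.
Qed.

End cubes.

(** * From the endpoint inequality to bounded mean oscillation *)

Section oscillation.
Context {R : realType} {n : nat}.
Local Notation V := 'rV[R]_n.+1.
Local Notation X := (lebesgue_rV R n).
Local Notation d := n.+1.
Variables (Omega : V -> R) (b : X -> R) (B : R).
Hypothesis admOmega : admissible_symbol Omega.
Hypothesis locb : loc_integrable b.
Let K := homogeneous_kernel Omega.
Hypothesis endpoint : forall (t : R) (f : X -> R),
  0 < t -> bounded_compact_support f ->
  (leb [set x | commutator_defined K b f x /\ (t < `|commutator K b f x|)%R]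
   <= \int[leb]_x (B * `|f x| / t * (1 + logp (B * `|f x| / t)))%:E)%E.

(** If t exceeded 2^(d+1) B, then u = B / t would be below 2^-(d+1) and the right-hand side below
    2^-(d+1) (2l)^d = l^d / 2, less than the measure of [E]. *)
Lemma endpoint_indic (t l : R) (a : V) (F E : set X) : 0 < t -> 0 < l ->
  measurable F -> F `<=` cube a l -> ((l ^+ d / 2)%:E <= leb E)%E ->
  (forall x, E x -> commutator_defined K b (\1_F) x /\
                    t < `|commutator K b (\1_F) x|) ->
  t <= 2 ^+ d.+1 * B.
Proof.
move=> t0 l0 mF FQ lE Et.
have := endpoint _ _ t0 (indic_bounded_compact_support _ _ _ mF FQ).
set u := B / t.
have -> : (\int[leb]_x (B * `|\1_F x| / t * (1 + logp (B * `|\1_F x| / t)))%:E =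
    \int[leb]_(x in F) (cst (u * (1 + logp u))%:E) x)%E.
  rewrite [RHS]integral_mkcond; apply: eq_integral => x _; rewrite /patch indicE.
  by case: ifP => _ /=; rewrite ?normr1 ?normr0 ?mulr1// mulr0 !mul0r.
rewrite integral_cst//.
have : (leb F <= ((2 * l) ^+ d)%:E)%E.
  apply: le_trans (cube_le a _ l0).
  by apply: le_measure; rewrite ?inE//; exact: measurable_cube.
have : (leb E <= leb [set x | commutator_defined K b \1_F x /\
     (t < `|commutator K b \1_F x|)%R])%E by exact: le_lebesgue_outer.
move=> /(le_trans lE) h1 hF h2; have := le_trans h1 h2.
have F0 : (0 <= leb F)%E by exact: measure_ge0.
move: (leb F) F0 hF {h2} => [p| |]//.
rewrite -EFinM !lee_fin => p0 pl lp.
rewrite leNgt; apply/negP => tB.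
have P0 : 0 < 2 ^+ d.+1 :> R by rewrite exprn_gt0.
have uP : u < (2 ^+ d.+1)^-1.
  by rewrite /u ltr_pdivrMr// ltr_pdivlMl.
have u1 : u <= 1.
  by rewrite (le_trans (ltW uP))// invf_le1// exprn_ege1// ler1n.
(* This covers [B] <= 0 too, as [ln] is at most 0 at every u <= 1, nonpositive u included. *)
have lnu : ln u <= 0 by exact: ln_le0.
move: lp; rewrite /logp max_r// addr0 mulr1 leNgt => /negP; apply.
have ld0 : 0 < l ^+ d by rewrite exprn_gt0.
(* For |F| = 0 the strict bound on u is lost in the product, but l^d / 2 > 0 is enough. *)
have [->|pn0] := eqVneq p 0; first by rewrite mulr0 divr_gt0.
rewrite (@lt_le_trans _ _ ((2 ^+ d.+1)^-1 * p))//.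
  by rewrite ltr_pM2r// lt_neqAle eq_sym pn0.
rewrite ler_pdivrMl// (le_trans pl)// exprMn [2 ^+ d.+1]exprS.
by rewrite le_eqVlt; apply/orP; left; apply/eqP; field.
Qed.

(** The constant and the direction [w] precede the cube, the level and the sign, so both signs can
    be used on one cube with one translate. |B| makes the constant nonnegative. *)
Lemma positive_part_oscillation : exists C : R, 0 <= C /\ exists w : V,
  forall (l : R) (a : V) (s m : R), 0 < l -> `|s| = 1 ->
  ((l ^+ d / 2)%:E <=
    leb (cube (a + l *: w) l `&` [set x : X | s * (b x - m) <= 0]%R))%E ->
  \int[leb]_(x in cube a l) Num.max (s * (b x - m)) 0 <= C * l ^+ d.
Proof.
have [w [c [C [c0 wK]]]] := homogeneous_kernel_cone _ admOmega.
have C1_ge0 : 0 <= 2 * (2 ^+ d.+1 * `|B|) / c.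
  apply: divr_ge0; last exact: ltW.
  by apply: mulr_ge0 => //; apply: mulr_ge0 => //; apply: exprn_ge0.
exists (2 * (2 ^+ d.+1 * `|B|) / c); split => //.
exists w => l a s m l0 s1; set E := _ `&` _ => lE.
have ld0 : 0 < l ^+ d by rewrite exprn_gt0.
set Q := cube a l; pose beta (x : X) := s * (b x - m).
have mQ : measurable Q by exact: measurable_cube.
have [mb _] := locb.
have mbeta : measurable_fun setT beta.
  exact: (measurable_funM (measurable_cst s) (measurable_funB mb (measurable_cst m))).
pose F := Q `&` [set x | 0 < beta x].
have mF : measurable F.
  by rewrite /F -preimage_itvoy; apply: measurable_funTS mQ _ _.
(* Each coordinate of x - y - l w is a difference of two numbers in [0, l]. *)
have far (x y : V) : E x -> Q y ->
    l <= enorm (x - y) /\ c / l ^+ d <= K (x - y) <= C / l ^+ d.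
  move=> [xQ' _] yQ; apply: wK => // i; have := xQ' i; have := yQ i.
  rewrite !mxE ler_norml; lra.
set A := (X in X <= _).
have A0 : 0 <= A by apply: Rintegral_ge0 => x _; rewrite le_max lexx orbT.
have ib : leb.-integrable Q (EFin \o b) by exact: loc_integrable_cube.
have ifin (g : R) : leb.-integrable Q (EFin \o cst g).
  exact: integrable_cst_cube.
have comm x : E x -> commutator_defined K b (\1_F) x /\
    c * A / l ^+ d <= s * commutator K b (\1_F) x.
  move=> Ex.
  have farE y (Qy : Q y) := (far x y Ex Qy).1.
  have [|cd ->] := @commutator_far _ _ K Q x l l0 farE b (\1_F).
    by move=> y nQ; rewrite indicE memNset// => -[].
  split=> //.
  have mK : measurable_fun Q (fun y : X => K (x - (y : V))).
    have cB (y : V) : {for y, continuous (fun y : V => (x : V) - y)}.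
      by apply: (@cvgB _ _ _ (nbhs y)); [exact: cvg_cst|exact: cvg_id].
    have oD : open [set y : V | (x : V) - y != 0].
      apply: (@open_comp _ _ (fun y : V => (x : V) - y) [set z | z != 0]).
        by move=> y _; exact: cB.
      exact: open_nonzero.
    apply: (@measurable_funS _ _ X _ ([set y : V | (x : V) - y != 0] : set X)).
    - exact: open_measurable_lebesgue.
    - move=> y /(far x y Ex)[ly _] /=.
      by rewrite -enorm_gt0 (lt_le_trans l0).
    - apply: continuous_open_measurable => // y xy0.
      apply: (@continuous_comp _ _ _ (fun y : V => (x : V) - y) K) => //.
      exact: homogeneous_kernel_continuous.
  have mF1 : measurable_fun Q (\1_F : X -> R) by exact: measurable_indic.
  have mbQ : measurable_fun Q b by exact: measurable_funTS.
  (* The upper kernel bound gives the domination that makes both integrals of the commutator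
     converge, so that they can be merged into one. *)
  pose k := C / l ^+ d.
  have Kk y : Q y -> `|K (x - (y : V))| <= k.
    move=> /(far x y Ex)[_ /andP[cK KC]]; rewrite ger0_norm//.
    by rewrite (le_trans _ cK)// divr_ge0// ltW.
  have F1 y : `|\1_F y| <= 1 :> R.
    by rewrite indicE; case: (_ \in _); rewrite ?normr1 ?normr0.
  have iKf : leb.-integrable Q (EFin \o (fun y : X => K (x - (y : V)) * \1_F y)).
    have mKf := measurable_funM mK mF1.
    apply: (le_integrable_EFin _ _ _ (cst k) mQ mKf); last exact: ifin.
    move=> y Qy; rewrite normrM -[leRHS]mulr1; apply: ler_pM => //.
    by rewrite (le_trans (Kk y Qy))//= ler_norm.
  have iKbf : leb.-integrable Q
      (EFin \o (fun y : X => K (x - (y : V)) * (b y * \1_F y))).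
    have mKbf := measurable_funM mK (measurable_funM mbQ mF1).
    apply: (le_integrable_EFin _ _ _ (fun y => k * b y) mQ mKbf); last first.
      exact: integrable_EFinZl.
    move=> y Qy; rewrite (normrM (K _)) (normrM (b y)) (normrM k).
    apply: ler_pM => //; first by rewrite (le_trans (Kk y Qy))// ler_norm.
    by rewrite -[leRHS]mulr1; apply: ler_pM.
  have ibeta : leb.-integrable Q (EFin \o (fun y => Num.max (beta y) 0)).
    have mmax : measurable_fun Q (fun y => Num.max (beta y) 0).
      exact: measurable_maxr (measurable_funTS mbeta) (measurable_cst (0 : R)).
    have iB := integrable_EFinB _ _ _ _ mQ ib (ifin m).
    apply: (le_integrable_EFin _ _ _ (fun y => b y - m) mQ mmax); last exact: iB.
    move=> y _; rewrite -[leRHS]mul1r -s1 -normrM -/(beta y).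
    by case: (leP (beta y) 0) => // _; rewrite normr0.
  have ibKf := integrable_EFinZl _ _ (b x) _ mQ iKf.
  have iD := integrable_EFinB _ _ _ _ mQ iKbf ibKf.
  rewrite -RintegralZl// -RintegralB// -RintegralZl// mulrAC -RintegralZl//.
  apply: le_Rintegral => //; [exact: integrable_EFinZl..|].
  move=> y Qy; have [_ /andP[cK _]] := far x y Ex Qy; have [_ bx] := Ex.
  have [b0|b0] := leP (beta y) 0.
    rewrite indicE memNset ?mulr0 ?subrr ?mulr0// => -[_ /=].
    by rewrite ltNge b0.
  have Fy : F y by split.
  rewrite indicE (mem_set Fy).
  (* The level [m] cancels in beta y - beta x, and this is at least beta y since beta x <= 0 on
     [E]. *)
  rewrite !mulr1 (_ : _ * (_ - _) = K (x - (y : V)) * (beta y - beta x)); last first.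
    by rewrite /beta; ring.
  have clK : 0 <= c / l ^+ d by rewrite divr_ge0// ltW.
  apply: ler_pM => //; first exact: ltW.
  by rewrite lerDl oppr_ge0.
have [A00|A_gt0] := leP A 0.
  by apply: (le_trans A00); apply: mulr_ge0 => //; exact: ltW.
(* Half of the lower bound, since the level set in the endpoint inequality is strict. *)
pose t := c * A / l ^+ d / 2.
have t0 : 0 < t by rewrite !divr_gt0// mulr_gt0.
have := @endpoint_indic t l a F E t0 l0 mF (@subIsetl _ _ _) lE.
have tE x : E x -> commutator_defined K b (\1_F) x /\ t < `|commutator K b (\1_F) x|.
  move=> /comm[cd ct]; split => //.
  rewrite (@lt_le_trans _ _ (s * commutator K b \1_F x))//.
    rewrite (lt_le_trans _ ct)// /t ltr_pdivrMr// ltr_pMr// ?ltr1n//.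
    by rewrite divr_gt0// mulr_gt0.
  by rewrite (le_trans (ler_norm _))// normrM s1 mul1r.
move=> /(_ tE) tB.
have {}tB : t <= 2 ^+ d.+1 * `|B|.
  by rewrite (le_trans tB)// ler_wpM2l ?exprn_ge0// ler_norm.
have -> : A = 2 * t / c * l ^+ d.
  by rewrite /t; field; rewrite !gt_eqF.
by rewrite ler_pM2r// ler_pM2r ?invr_gt0// ler_pM2l.
Qed.

(** The two signs bound the integral of |b - m| by 2 C l^d; replacing the median on Q' by the mean
    on Q costs as much again, whence 4 C after l^d <= |Q|. *)
Lemma endpoint_BMO : BMO b.
Proof.
split=> //.
have [C [C0 [w Cw]]] := positive_part_oscillation.
suff : (ereal_sup [set mean_oscillation b (cube q.1 q.2)
             | q in [set q : V * R | (0 < q.2)%R]] <= (4 * C)%:E)%E.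
  by move=> /le_lt_trans -> //; exact: ltry.
apply: ge_ereal_sup => _ [[a l] /= l0 <-].
have [mb _] := locb.
have ld0 : 0 < l ^+ d by rewrite exprn_gt0.
set Q := cube a l; set Q' : set X := cube (a + l *: w) l.
have mQ : measurable Q by exact: measurable_cube.
have cube_num (a' : V) : exists2 q : R, leb (cube a' l) = q%:E & l ^+ d <= q.
  exists (fine (leb (cube a' l))); last rewrite -lee_fin;
    rewrite fineK ?cube_ge// ?ltW//;
    by rewrite ge0_fin_numE ?cube_finite// measure_ge0.
have [q qE lq] := cube_num a; have [q' qE' lq'] := cube_num (a + l *: w).
have q0 : 0 < q by exact: lt_le_trans lq.
have [m [mle mge]] := median_exists leb Q' b q' (measurable_cube _ _)
  (measurable_funTS mb) qE' (lt_le_trans ld0 lq').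
have half : ((l ^+ d / 2)%:E <= (q' / 2)%:E)%E by rewrite lee_fin ler_pM2r.
have pos : \int[leb]_(x in Q) Num.max (1 * (b x - m)) 0 <= C * l ^+ d.
  apply: Cw => //; first exact: normr1.
  apply: le_trans half (le_trans mle _).
  by apply: le_lebesgue_outer => x [Qx /= bx]; split=> //=; rewrite mul1r subr_le0.
have neg : \int[leb]_(x in Q) Num.max (-1 * (b x - m)) 0 <= C * l ^+ d.
  apply: Cw => //; first exact: normrN1.
  apply: le_trans half (le_trans mge _).
  apply: le_lebesgue_outer => x [Qx /= bx].
  by split=> //=; rewrite mulN1r oppr_le0 subr_ge0.
have ibm (r : R) : leb.-integrable Q (EFin \o (fun x => b x - r)).
  apply: integrable_EFinB => //; first exact: loc_integrable_cube.
  exact: integrable_cst_cube.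
have imax (s : R) : `|s| = 1 ->
    leb.-integrable Q (EFin \o (fun x => Num.max (s * (b x - m)) 0)).
  move=> s1; have mB : measurable_fun Q (fun x => b x - m).
    exact: measurable_funB (measurable_funTS mb) (measurable_cst m).
  have mM : measurable_fun Q (fun x => Num.max (s * (b x - m)) 0).
    have mM := measurable_funM (measurable_cst s) mB.
    exact: measurable_maxr mM (measurable_cst (0 : R)).
  apply: (le_integrable_EFin _ _ _ (fun x => b x - m) mQ mM) (ibm m) => x _.
  rewrite -[leRHS]mul1r -s1 -normrM.
  by case: (leP (s * (b x - m)) 0) => // _; rewrite normr0.
have iabs (r : R) : leb.-integrable Q (EFin \o (fun x => `|b x - r|)).
  have := ibm r; exact: integrable_norm.
have absE : \int[leb]_(x in Q) `|b x - m| <= 2 * C * l ^+ d.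
  have -> : \int[leb]_(x in Q) `|b x - m| =
      \int[leb]_(x in Q) Num.max (1 * (b x - m)) 0 +
      \int[leb]_(x in Q) Num.max (-1 * (b x - m)) 0.
    rewrite -RintegralD//; [|exact: imax (normr1 _)|exact: imax (normrN1 _)].
    apply: eq_Rintegral => x _; exact: normr_positive_parts.
  by rewrite -mulrA mulr_natl mulr2n; exact: lerD.
have meanE : `|m - cube_mean b Q| <= 2 * C * l ^+ d / q.
  (* The gap between median and mean is, up to sign, the mean of b - m, so the bound on |b - m|
     controls it. *)
  have -> : m - cube_mean b Q = - (q^-1 * \int[leb]_(x in Q) (b x - m)).
    rewrite RintegralB//; [|exact: loc_integrable_cube|exact: integrable_cst_cube].
    by rewrite Rintegral_cst// qE /cube_mean qE /=; field; rewrite gt_eqF.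
  rewrite normrN normrM gtr0_norm ?invr_gt0// mulrC ler_pM2r ?invr_gt0//.
  by apply: le_trans absE; exact: le_normr_Rintegral.
rewrite /mean_oscillation qE /=; set mu := cube_mean b Q.
have -> : (\int[leb]_(x in Q) `|b x - mu|%:E =
    (\int[leb]_(x in Q) `|b x - mu|)%:E)%E.
  by rewrite /Rintegral fineK//; exact: integrable_fin_num (iabs mu).
rewrite -EFinM lee_fin ler_pdivrMl//.
apply: (@le_trans _ _ (\int[leb]_(x in Q) (`|b x - m| + `|m - mu|))).
  apply: le_Rintegral => //.
    exact: (integrable_EFinD _ _ _ _ mQ (iabs m) (integrable_cst_cube a l `|m - mu| l0)).
  by move=> x _; rewrite (le_trans _ (ler_normD _ _))// addrA subrK.
rewrite (RintegralD mQ (iabs m) (integrable_cst_cube a l `|m - mu| l0)).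
rewrite Rintegral_cst// qE /=.
have h : `|m - mu| * q <= 2 * C * l ^+ d by rewrite -ler_pdivlMr.
have h2 : C * l ^+ d <= C * q by rewrite ler_wpM2l.
lra.
Qed.

End oscillation.

Theorem mainTheorem5 (R : realType) (n : nat) :
  (forall Omega : 'rV[R]_n.+1 -> R, admissible_symbol Omega ->
   forall b : lebesgue_rV R n -> R, loc_integrable b ->
   (exists B : R, forall (t : R) (f : lebesgue_rV R n -> R),
      0 < t -> bounded_compact_support f ->
      (leb [set x | commutator_defined (homogeneous_kernel Omega) b f x /\
                    (t < `|commutator (homogeneous_kernel Omega) b f x|)%R]
       <= \int[leb]_x (B * `|f x| / t * (1 + logp (B * `|f x| / t)))%:E)%E) ->
   BMO b)
  /\
  (forall j : 'I_n.+1, exists2 Omega : 'rV[R]_n.+1 -> R,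
     admissible_symbol Omega & homogeneous_kernel Omega = riesz_kernel j).
Proof.
split=> [f adm_f b locb [B endpoint]|j].
  exact: (endpoint_BMO _ _ _ adm_f locb endpoint).
exists (fun x : 'rV[R]_n.+1 => x ord0 j / enorm x); first exact: riesz_symbol_admissible.
exact: homogeneous_kernel_riesz.
Qed.
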